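(* Let $R$ be a complete hemiring. The following are equivalent: (i) $R$ is congruence-simple; (ii) $R$ is cc-simple; (iii) $|R|\le 2$, or $R$ is isomorphic to a dense complete subhemiring $S\subseteq \mathrm{CEnd}_{\mathbf{B}}(M)$ of the complete endomorphism hemiring $\mathrm{CEnd}_{\mathbf{B}}(M)$ of a nonzero complete lattice $M$.
   Context: A hemiring $(R,+,\cdot,0)$ consists of a commutative monoid $(R,+,0)$ and a semigroup $(R,\cdot)$ such that multiplication distributes over addition on both sides and $0r=0=r0$ for all $r$. A hemiring $R$ is complete if for every index set $\Omega$ and every family $(m_i)_{i\in\Omega}$ in $R$ an element $\sum_{i\in\Omega}m_i\in R$ is given such that: the sum over $\emptyset$ is $0$; $\sum_{i\in\{1\}}m_i=m_1$; $\sum_{i\in\{1,2\}}m_i=m_1+m_2$; $\sum_{i\in\Omega}m_i=\sum_{j\in\Lambda}\big(\sum_{i\in\Omega_j}m_i\big)$ for every partition $\Omega=\bigcup_{j\in\Lambda}\Omega_j$ into disjoint nonempty subsets; and $r\big(\sum_{i\in\Omega}m_i\big)=\sum_{i\in\Omega}rm_i$, $\big(\sum_{i\in\Omega}m_i\big)r=\sum_{i\in\Omega}m_ir$ for all $r\in R$. Complete homomorphisms of complete hemirings are hemiring homomorphisms preserving all these sums, and isomorphism of complete hemirings is meant in this sense; a complete subhemiring is a subhemiring closed under all these sums. $R$ is congruence-simple if the diagonal and $R^2$ are its only (hemiring) congruences. A congruence $\rho$ on a complete hemiring is complete if $m_i\,\rho\,m_i'$ for all $i\in\Omega$ implies $\big(\sum_{i\in\Omega}m_i\big)\rho\big(\sum_{i\in\Omega}m_i'\big)$,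 for all families; $R$ is cc-simple (complete congruence-simple) if the diagonal and $R^2$ are its only complete congruences. For a complete lattice $M$ with least element $0$, $\mathrm{CEnd}_{\mathbf{B}}(M)$ is the set of all maps $M\to M$ preserving arbitrary joins (including the empty join $0$), which is a complete hemiring under pointwise sums (joins) and composition. For $a,b\in M$, $e_{a,b}:M\to M$ is given by $e_{a,b}(x)=0$ if $x\le a$ and $e_{a,b}(x)=b$ otherwise; a subhemiring $S$ of $\mathrm{CEnd}_{\mathbf{B}}(M)$ is dense if $e_{a,b}\in S$ for all $a,b\in M$. *)

(* Defs.v *)
From HB Require Import structures.
From mathcomp Require Import all_boot all_order all_algebra.
From mathcomp Require Import boolp classical_sets functions cardinality.

Set Implicit Arguments.
Unset Strict Implicit.
Unset Printing Implicit Defensive.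

Import Order.TTheory GRing.Theory.
Local Open Scope classical_set_scope.
Local Open Scope ring_scope.

(* Hemirings need not have a multiplicative identity, so the multiplication
   is that of a semigroupType, written ( * )%g, and not that of GRing. *)
HB.mixin Record Nmodule_Semigroup_isHemiring R
    of GRing.Nmodule R & Semigroup R := {
  hmulDl : forall x y z : R, ((x + y) * z)%g = (x * z)%g + (y * z)%g ;
  hmulDr : forall x y z : R, (x * (y + z))%g = (x * y)%g + (x * z)%g ;
  hmul0r : forall x : R, ((0 : R) * x)%g = 0 ;
  hmulr0 : forall x : R, (x * (0 : R))%g = 0
}.

#[short(type="hemiringType")]
HB.structure Definition Hemiring :=
  {R of Nmodule_Semigroup_isHemiring R & GRing.Nmodule R
      & Semigroup R}.

(* A single universe of index sets, shared by the sum operation and all the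
   axioms about it; it contains the carriers of all hemirings and lattices,
   and their power sets. *)
Definition indexType := Type.

(* The axioms on empty, one-element and two-element index sets are stated for
   every index type of that cardinality: there is no separate axiom of
   invariance under reindexing, which instead follows from [csum1] and
   [csum_partition]. *)
HB.mixin Record Hemiring_isComplete R of Hemiring R := {
  csum : forall I : indexType, (I -> R) -> R ;
  csum0 : forall (I : indexType) (m : I -> R), (I -> False) -> csum _ m = 0 ;
  csum1 : forall (I : indexType) (m : I -> R) (i : I),
    (forall k, k = i) -> csum _ m = m i ;
  csum2 : forall (I : indexType) (m : I -> R) (i j : I),
    i <> j -> (forall k, k = i \/ k = j) -> csum _ m = m i + m j ;
  csum_partition : forall (I J : indexType) (F : J -> set I) (m : I -> R),
    partition [set: J] F [set: I] ->
    csum _ m = csum _ (fun j : J => csum _ (fun i : F j => m (val i))) ;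
  csum_distrl : forall (I : indexType) (m : I -> R) (r : R),
    (r * csum _ m)%g = csum _ (fun i => (r * m i)%g) ;
  csum_distrr : forall (I : indexType) (m : I -> R) (r : R),
    (csum _ m * r)%g = csum _ (fun i => (m i * r)%g)
}.

#[short(type="completeHemiringType")]
HB.structure Definition CompleteHemiring :=
  {R of Hemiring_isComplete R & Hemiring R}.

Arguments csum {R I} m : rename.

Definition complete_hom (R T : completeHemiringType) (f : R -> T) : Prop :=
  [/\ f 0 = 0, {morph f : x y / x + y}, {morph f : x y / (x * y)%g}
    & forall (I : indexType) (m : I -> R), f (csum m) = csum (fun i => f (m i))].

Record congruence (R : hemiringType) (rho : R -> R -> Prop) : Prop := {
  congr_equiv : RelationClasses.Equivalence rho ;
  congrD : forall x x' y y', rho x x' -> rho y y' -> rho (x + y) (x' + y') ;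
  congrM : forall x x' y y',
    rho x x' -> rho y y' -> rho (x * y)%g (x' * y')%g
}.

Record complete_congruence (R : completeHemiringType) (rho : R -> R -> Prop)
    : Prop := {
  ccongr_congr : congruence rho ;
  congr_csum : forall (I : indexType) (m m' : I -> R),
    (forall i, rho (m i) (m' i)) -> rho (csum m) (csum m')
}.

Definition trivial_relation (T : Type) (rho : T -> T -> Prop) : Prop :=
  (forall x y, rho x y <-> x = y) \/ (forall x y, rho x y).

Definition congruence_simple (R : hemiringType) : Prop :=
  forall rho : R -> R -> Prop, congruence rho -> trivial_relation rho.

Definition cc_simple (R : completeHemiringType) : Prop :=
  forall rho : R -> R -> Prop, complete_congruence rho -> trivial_relation rho.

Record complete_subhemiring (R : completeHemiringType) (S : set R) : Prop := {
  csub0 : S 0 ;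
  csubD : forall x y, S x -> S y -> S (x + y) ;
  csubM : forall x y, S x -> S y -> S (x * y)%g ;
  csub_csum : forall (I : indexType) (m : I -> R),
    (forall i, S (m i)) -> S (csum m)
}.

(* R is isomorphic to the complete subhemiring S, the latter being equipped
   with the restrictions of the operations of T. *)
Definition complete_isomorphic_to (R T : completeHemiringType) (S : set T)
    : Prop :=
  exists2 f : R -> T, complete_hom f & set_bij [set: R] S f.

HB.mixin Record TBLattice_isComplete d M of Order.TBLattice d M := {
  bigjoin : set M -> M ;
  bigjoin_supremum : forall A : set M, supremums A (bigjoin A)
}.

#[short(type="completeLatticeType")]
HB.structure Definition CompleteLattice d :=
  {M of TBLattice_isComplete d M & Order.TBLattice d M}.

Arguments bigjoin {d M} A : rename.

Section BigJoin.
Context {d : Order.disp_t} {M : completeLatticeType d}.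
Implicit Types (A : set M) (x : M).

Lemma bigjoin_ub A x : A x -> (x <= bigjoin A)%O.
Proof. by have [ub _] := bigjoin_supremum A; apply: ub. Qed.

Lemma bigjoin_least A x :
  (forall y, A y -> (y <= x)%O) -> (bigjoin A <= x)%O.
Proof. by have [_ lub] := bigjoin_supremum A; apply: lub. Qed.

Lemma bigjoin0 : bigjoin set0 = \bot%O :> M.
Proof. by apply/eqP; rewrite -lex0; apply: bigjoin_least. Qed.

Lemma bigjoin1 x : bigjoin [set x] = x.
Proof.
apply/eqP; rewrite eq_le bigjoin_ub // andbT.
by apply: bigjoin_least => y ->.
Qed.

Lemma bigjoin2 x y : bigjoin [set x; y] = (x `|` y)%O.
Proof.
apply/eqP; rewrite eq_le; apply/andP; split.
  by apply: bigjoin_least => z [->|->]; rewrite ?leUl ?leUr.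
by rewrite leUx; apply/andP; split; apply: bigjoin_ub; [left|right].
Qed.

Lemma le_bigjoinP A x : reflect (forall y, A y -> (y <= x)%O) (bigjoin A <= x)%O.
Proof.
apply: (iffP idP) => [le_Ax y Ay|]; last exact: bigjoin_least.
exact: le_trans (bigjoin_ub Ay) le_Ax.
Qed.

End BigJoin.

Definition join_preserving d (M : completeLatticeType d) (f : M -> M) : Prop :=
  forall A : set M, f (bigjoin A) = bigjoin (f @` A).

Record cEnd d (M : completeLatticeType d) := CEnd {
  cEnd_fun :> M -> M ;
  cEndP : join_preserving cEnd_fun
}.
Arguments CEnd {d M cEnd_fun} cEndP : rename.

Section CompleteEndomorphisms.
Context {d : Order.disp_t} {M : completeLatticeType d}.
Implicit Types f g h : cEnd M.

Lemma cEnd_eq f g : f =1 g -> f = g.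
Proof.
case: f g => [f fP] [g gP] /= /funext fg.
by rewrite -{}fg in gP *; congr CEnd; apply: Prop_irrelevance.
Qed.

HB.instance Definition _ := gen_eqMixin (cEnd M).
HB.instance Definition _ := gen_choiceMixin (cEnd M).

Definition cEnd_zero_fun (x : M) : M := \bot%O.
Definition cEnd_add_fun f g (x : M) : M := (f x `|` g x)%O.
Definition cEnd_mul_fun f g (x : M) : M := f (g x).
Definition cEnd_csum_fun (I : indexType) (m : I -> cEnd M) (x : M) : M :=
  bigjoin (range (fun i => m i x)).

Lemma cEnd_csum_subproof (I : indexType) (m : I -> cEnd M) :
  join_preserving (cEnd_csum_fun m).
Proof.
move=> A; apply/eqP; rewrite eq_le; apply/andP; split.
  apply/le_bigjoinP => _ [i _ <-]; rewrite cEndP.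
  apply/le_bigjoinP => _ [x Ax <-].
  apply: (@le_trans _ _ (cEnd_csum_fun m x)); first by apply: bigjoin_ub; exists i.
  by apply: bigjoin_ub; exists x.
apply/le_bigjoinP => _ [x Ax <-]; apply/le_bigjoinP => _ [i _ <-].
apply: (@le_trans _ _ (m i (bigjoin A))); last by apply: bigjoin_ub; exists i.
by rewrite cEndP; apply: bigjoin_ub; exists x.
Qed.

Lemma cEnd_zero_subproof : join_preserving cEnd_zero_fun.
Proof.
move=> A; apply/eqP; rewrite eq_sym -lex0.
by apply/le_bigjoinP => _ [x _ <-].
Qed.

Lemma cEnd_add_funE f g :
  cEnd_add_fun f g = cEnd_csum_fun (fun b : bool => if b then f else g).
Proof.
apply/funext => x; rewrite /cEnd_add_fun -bigjoin2; congr bigjoin.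
apply/seteqP; split => [_ [->|->]|_ [[] _ <-]]; [by exists true|by exists false|
  by left|by right].
Qed.

Lemma cEnd_add_subproof f g : join_preserving (cEnd_add_fun f g).
Proof. rewrite cEnd_add_funE; exact: cEnd_csum_subproof. Qed.

Lemma cEnd_mul_subproof f g : join_preserving (cEnd_mul_fun f g).
Proof. by move=> A; rewrite /cEnd_mul_fun !cEndP image_comp. Qed.

Definition cEnd_zero : cEnd M := CEnd cEnd_zero_subproof.
Definition cEnd_add f g : cEnd M := CEnd (cEnd_add_subproof f g).
Definition cEnd_mul f g : cEnd M := CEnd (cEnd_mul_subproof f g).
Definition cEnd_csum (I : indexType) (m : I -> cEnd M) : cEnd M :=
  CEnd (cEnd_csum_subproof m).

Lemma cEnd0 f : f \bot%O = \bot%O.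
Proof. by rewrite -bigjoin0 cEndP image_set0. Qed.

Lemma cEndU f x y : f (x `|` y)%O = (f x `|` f y)%O.
Proof. by rewrite -!bigjoin2 cEndP image_setU !image_set1. Qed.

Lemma cEnd_addA : associative cEnd_add.
Proof. by move=> f g h; apply: cEnd_eq => x; exact: joinA. Qed.
Lemma cEnd_addC : commutative cEnd_add.
Proof. by move=> f g; apply: cEnd_eq => x; exact: joinC. Qed.
Lemma cEnd_add0 : left_id cEnd_zero cEnd_add.
Proof. by move=> f; apply: cEnd_eq => x; exact: join0x. Qed.
Lemma cEnd_mulA : associative cEnd_mul.
Proof. by move=> f g h; apply: cEnd_eq. Qed.

HB.instance Definition _ :=
  GRing.isNmodule.Build (cEnd M) cEnd_addA cEnd_addC cEnd_add0.
HB.instance Definition _ := isSemigroup.Build (cEnd M) cEnd_mulA.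

Lemma cEnd_mulDl f g h : ((f + g) * h)%g = (f * h)%g + (g * h)%g.
Proof. exact: cEnd_eq. Qed.
Lemma cEnd_mulDr f g h : (f * (g + h))%g = (f * g)%g + (f * h)%g.
Proof. by apply: cEnd_eq => x; apply: cEndU. Qed.
Lemma cEnd_mul0r f : ((0 : cEnd M) * f)%g = 0.
Proof. exact: cEnd_eq. Qed.
Lemma cEnd_mulr0 f : (f * (0 : cEnd M))%g = 0.
Proof. by apply: cEnd_eq => x; apply: cEnd0. Qed.

HB.instance Definition _ := Nmodule_Semigroup_isHemiring.Build (cEnd M)
  cEnd_mulDl cEnd_mulDr cEnd_mul0r cEnd_mulr0.

Lemma cEnd_csum0 (I : indexType) (m : I -> cEnd M) :
  (I -> False) -> cEnd_csum m = 0.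
Proof.
move=> I0; apply: cEnd_eq => x; apply: eq_trans bigjoin0.
by congr bigjoin; apply/seteqP; split => // _ [i _ <-]; case: (I0 i).
Qed.

Lemma cEnd_csum1 (I : indexType) (m : I -> cEnd M) (i : I) :
  (forall k, k = i) -> cEnd_csum m = m i.
Proof.
move=> I1; apply: cEnd_eq => x; rewrite -[RHS]bigjoin1; congr bigjoin.
by apply/seteqP; split => [_ [k _ <-]|_ ->]; [rewrite (I1 k)|exists i].
Qed.

Lemma cEnd_csum2 (I : indexType) (m : I -> cEnd M) (i j : I) :
  i <> j -> (forall k, k = i \/ k = j) -> cEnd_csum m = m i + m j.
Proof.
move=> _ I2; apply: cEnd_eq => x; apply: eq_trans (bigjoin2 _ _); congr bigjoin.
apply/seteqP; split => [_ [k _ <-]|_ [->|->]]; [|by exists i|by exists j].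
by case: (I2 k) => ->; [left|right].
Qed.

Lemma cEnd_csum_partition (I J : indexType) (F : J -> set I) (m : I -> cEnd M) :
  partition [set: J] F [set: I] ->
  cEnd_csum m = cEnd_csum (fun j : J => cEnd_csum (fun i : F j => m (val i))).
Proof.
move=> [covF _ _]; apply: cEnd_eq => x.
apply/eqP; rewrite eq_le; apply/andP; split; apply/le_bigjoinP.
  move=> _ [i _ <-]; have [j _ Fji] : cover [set: J] F i by rewrite covF.
  apply: (@le_trans _ _ (cEnd_csum (fun k : F j => m (val k)) x)).
    by apply: bigjoin_ub; exists (exist _ i (mem_set Fji)).
  by apply: bigjoin_ub; exists j.
move=> _ [j _ <-]; apply/le_bigjoinP => _ [k _ <-].
by apply: bigjoin_ub; exists (val k).
Qed.

Lemma cEnd_csum_distrl (I : indexType) (m : I -> cEnd M) f :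
  (f * cEnd_csum m)%g = cEnd_csum (fun i => (f * m i)%g).
Proof.
apply: cEnd_eq => x; rewrite [LHS]cEndP; congr bigjoin.
by rewrite image_comp.
Qed.

Lemma cEnd_csum_distrr (I : indexType) (m : I -> cEnd M) f :
  (cEnd_csum m * f)%g = cEnd_csum (fun i => (m i * f)%g).
Proof. exact: cEnd_eq. Qed.

HB.instance Definition _ := Hemiring_isComplete.Build (cEnd M)
  cEnd_csum0 cEnd_csum1 cEnd_csum2 cEnd_csum_partition
  cEnd_csum_distrl cEnd_csum_distrr.

Definition e_fun (a b x : M) : M := if (x <= a)%O then \bot%O else b.

Lemma e_subproof a b : join_preserving (e_fun a b).
Proof.
move=> A; rewrite {1}/e_fun; case: ifPn => [/le_bigjoinP leA|nleA].
  apply/eqP; rewrite eq_sym -lex0; apply/le_bigjoinP => _ [x Ax <-].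
  by rewrite /e_fun leA.
have [x Ax nxa] : exists2 x, A x & ~~ (x <= a)%O.
  apply: contrapT => noA; move/negP: nleA; apply; apply/le_bigjoinP => x Ax.
  by apply: contrapT => /negP nxa; apply: noA; exists x.
apply/eqP; rewrite eq_le; apply/andP; split.
  by apply: bigjoin_ub; exists x => //; rewrite /e_fun (negPf nxa).
by apply/le_bigjoinP => _ [y _ <-]; rewrite /e_fun; case: ifP.
Qed.

Definition e_end (a b : M) : cEnd M := CEnd (e_subproof a b).

Definition dense_in_cEnd (S : set (cEnd M)) : Prop :=
  forall a b : M, S (e_end a b).

End CompleteEndomorphisms.

(* Main.v *)
(* Let R be cc-simple with more than two elements. Comparing K-fold multiples of
   elements shows that constant sums over nonempty index sets are trivial, so R
   is a complete lattice whose sums are joins; let T be its greatest element.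
   For a <> T the syntactic congruence of the set of elements below a is
   trivial, which yields T * T = T and T * x * T = T for all x <> 0. In
   CEnd(M) one has T = e_{0,1}, and the left ideal of the maps e_{0,b} is a copy
   of M; accordingly we let R act by left multiplication on the lattice
   M = R * T = {x | x * T = x}. If s is the greatest left annihilator of a in M,
   then b * T * s acts as e_{a,b}. *)

Require Import Defs.
From HB Require Import structures.
From mathcomp Require Import all_boot all_order all_algebra.
From mathcomp Require Import boolp classical_sets functions cardinality.

Set Implicit Arguments.
Unset Strict Implicit.
Unset Printing Implicit Defensive.

Import Order.TTheory GRing.Theory.
Local Open Scope classical_set_scope.
Local Open Scope card_scope.

Lemma card_le_2P (T : Type) :
  [set: T] #<= `I_2 <-> exists f : T -> bool, injective f.
Proof.
split=> [/pcard_leP[f]|[f f_inj]].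
  exists (fun x => f x == 0) => x y exy.
  have lt2 z : f z < 2 by exact: (@funS _ _ _ _ f).
  have: f x = f y.
    by move: exy (lt2 x) (lt2 y); case: (f x) (f y) => [|[|?]] [|[|?]].
  by apply: (@inj _ _ _ f); rewrite in_setE.
have f'_inj : {in [set: T] &, injective (nat_of_bool \o f)}.
  by move=> x y _ _ /= exy; apply: f_inj; case: (f x) (f y) exy => [] [].
rewrite -(card_le_eql (inj_card_eq f'_inj)); apply: subset_card_le.
by move=> _ [x _ <-] /=; case: (f x).
Qed.

(** * Infinite sums in a complete hemiring *)

Section CompleteSums.
Local Open Scope ring_scope.
Local Open Scope group_scope.
Context {R : completeHemiringType}.
Implicit Types x y z r : R.

Lemma eq_csum (I : indexType) (m n : I -> R) : m =1 n -> csum m = csum n.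
Proof. by move=> /funext->. Qed.

Lemma csum_eq0 (I : indexType) : csum (fun _ : I => 0 : R) = 0.
Proof.
rewrite -{2}(hmul0r (csum (fun _ : I => 0 : R))) csum_distrl.
by apply: eq_csum => i; rewrite hmul0r.
Qed.

(** The singletons {f i}, indexed by [I], form a partition of [J], and each inner sum has a single
    term. *)
Lemma csum_reindex (I J : indexType) (f : I -> J) (m : J -> R) :
  bijective f -> csum m = csum (m \o f).
Proof.
move=> [g fK gK]; rewrite (@csum_partition _ _ _ (fun i => [set f i])).
  apply: eq_csum => i /=.
  rewrite (@csum1 _ _ _ (exist _ (f i) (mem_set (erefl (f i)))) _) // => k.
  by apply: val_inj; case: k => k /= /[!inE].
split=> [|i j _ _ [x [-> /(can_inj fK)]] //|i _]; last by exists (f i).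
by apply/seteqP; split=> // j _; exists (g j); rewrite //= gK.
Qed.

Lemma csum_pair (I J : indexType) (m : I * J -> R) :
  csum m = csum (fun i => csum (fun j => m (i, j))).
Proof.
(* Blocks of a partition must be nonempty, so the fibres of the first projection serve as blocks
   once [J] is inhabited. *)
have [[j0]|J0] := pselect (inhabited J); last first.
  rewrite csum0; last by case=> _ j; apply: J0.
  rewrite -[LHS](csum_eq0 I); apply: eq_csum => i.
  by rewrite csum0 // => j; apply: J0.
rewrite (@csum_partition _ _ _ (fun i => [set p | p.1 = i])).
  apply: eq_csum => i.
  pose f j : [set p : I * J | p.1 = i] :=
    exist _ (i, j) (mem_set (erefl _ : [set p | p.1 = i] (i, j))).
  rewrite (@csum_reindex _ _ f) //; exists (fun p => (val p).2) => // p.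
  by apply: val_inj; case: p => -[i' j] /= /[!inE] /= ->.
split=> [|i j _ _ [p [<- <-]] //|i _]; last by exists (i, j0).
by apply/seteqP; split=> // p _; exists p.1.
Qed.

Lemma csum_exchange (I J : indexType) (m : I -> J -> R) :
  csum (fun i => csum (m i)) = csum (fun j => csum (m^~ j)).
Proof.
transitivity (csum (fun p : I * J => m p.1 p.2)); first by rewrite csum_pair.
rewrite (@csum_reindex _ _ (fun p : J * I => (p.2, p.1))) ?csum_pair //.
by exists (fun p => (p.2, p.1)) => -[].
Qed.

Lemma csum_bool (m : bool -> R) : csum m = m true + m false.
Proof. by apply: csum2 => // -[]; [left|right]. Qed.

(** Binary addition is a sum over [bool], so this is an exchange of two sums. *)
Lemma csumD (I : indexType) (m n : I -> R) :
  csum (fun i => m i + n i) = csum m + csum n.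
Proof.
transitivity (csum (fun i => csum (fun b : bool => if b then m i else n i))).
  by apply: eq_csum => i; rewrite csum_bool.
by rewrite csum_exchange csum_bool.
Qed.

Lemma csumD1 (I : indexType) (i : I) (m : I -> R) :
  csum m = m i + csum (fun k : [set~ i] => m (val k)).
Proof.
(* The complement of [i] is an admissible block only if it is nonempty. *)
have [[j ji]|noj] := pselect (exists j, j <> i); last first.
  have alli k : k = i by apply: contrapT => ki; apply: noj; exists k.
  rewrite (@csum1 _ _ _ i) ?csum0 ?addr0 // => -[k] /= /[!inE]; exact.
rewrite (@csum_partition _ _ _ (fun b : bool => if b then [set i] else [set~ i])).
  rewrite csum_bool; congr (_ + _).
  rewrite (@csum1 _ _ _ (exist _ i (mem_set (erefl i)))) // => k.
  by apply: val_inj; case: k => k /= /[!inE].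
split=> [|[] [] _ _ [k []] //= |[] _]; [|by exists i|by exists j].
by apply/seteqP; split=> // k _; have [->|] := pselect (k = i); [exists true|exists false].
Qed.

(* Eilenberg's swindle: if S is the sum of countably many copies of x, then
   S = x + S, and S + T = 0 for the corresponding sum T of copies of y. *)
Lemma complete_zerosumfree x y : x + y = 0 -> x = 0.
Proof.
move=> xy0; pose S z := csum (fun _ : nat => z).
have SD : S x = x + S x.
  rewrite {1}/S (csumD1 0%N); congr (_ + _).
  pose f n : [set~ 0%N] := exist _ n.+1 (mem_set (not_eq_sym (O_S n))).
  rewrite (@csum_reindex _ _ f) //; exists (fun p => (val p).-1) => // p.
  by apply: val_inj; case: p => -[|n] //= /set_mem; case.
have ST0 : S x + S y = 0.
  by rewrite /S -csumD -[RHS](csum_eq0 nat); apply: eq_csum.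
by rewrite -[x]addr0 -ST0 addrA -SD.
Qed.

Lemma csum_const_eq0 (I : indexType) (i : I) x :
  csum (fun _ : I => x) = 0 -> x = 0.
Proof. by rewrite (csumD1 i) => /complete_zerosumfree. Qed.

End CompleteSums.

(** * Idempotence of constant sums over nonempty index sets *)

Definition csum_idempotent (R : completeHemiringType) : Prop :=
  forall (I : indexType) (i : I) (x : R), csum (fun _ : I => x) = x.

Section IdempotentSums.
Local Open Scope ring_scope.
Local Open Scope group_scope.
Context {R : completeHemiringType}.
Implicit Types x y z r : R.

Definition same_multiple (K : indexType) x y :=
  csum (fun _ : K => x) = csum (fun _ : K => y).

Lemma same_multiple_congruence (K : indexType) :
  complete_congruence (same_multiple K).
Proof.
split; last first.
  move=> I m m' mm'; rewrite /same_multiple.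
  by rewrite -!(csum_exchange (fun i (_ : K) => _ i)); apply: eq_csum.
split.
- by split=> // x y z; rewrite /same_multiple => ->.
- by move=> x x' y y'; rewrite /same_multiple !csumD => -> ->.
move=> x x' y y' xx' yy'; rewrite /same_multiple.
by rewrite -csum_distrl yy' csum_distrl -csum_distrr xx' csum_distrr.
Qed.

(* With K = nat -> I one has K * I ~ K, so that x and the I-fold multiple of x
   have the same K-fold multiple. *)
Lemma cc_simple_idempotent : cc_simple R -> csum_idempotent R.
Proof.
move=> simR I i x; pose K : indexType := nat -> I.
have [diag|total] := simR _ (same_multiple_congruence K).
  apply/diag; rewrite /same_multiple.
  rewrite -(csum_pair (fun _ : K * I => x)).
  pose f (p : K * I) : K := fun n => if n is n'.+1 then p.1 n' else p.2.
  rewrite (@csum_reindex _ _ _ f (fun _ : K => x)) //.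
  exists (fun k : K => (fun n => k n.+1, k 0%N)) => [[k j]|k] //=.
  by apply/funext => -[].
(* In the total case every [K]-fold multiple equals that of 0, and [K] is inhabited by a constant
   sequence. *)
have all0 y : y = 0.
  apply: (@csum_const_eq0 _ K (fun=> i)); rewrite -[RHS](csum_eq0 K).
  exact: total.
by rewrite (all0 x) csum_eq0.
Qed.

End IdempotentSums.

(** * The natural order, for which sums are suprema *)

Definition greatest (R : completeHemiringType) : R := csum id.

Section NaturalOrder.
Local Open Scope ring_scope.
Local Open Scope group_scope.
Context {R : completeHemiringType} (idR : csum_idempotent R).
Implicit Types x y z r : R.

Definition nat_le x y := x + y = y.

Lemma addrr x : x + x = x.
Proof. by rewrite -(csum_bool (fun=> x)) (idR true). Qed.

Lemma nat_le_refl x : nat_le x x.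
Proof. exact: addrr. Qed.

Lemma nat_le_anti x y : nat_le x y -> nat_le y x -> x = y.
Proof. by rewrite /nat_le => xy yx; rewrite -yx addrC. Qed.

Lemma nat_le_trans x y z : nat_le x y -> nat_le y z -> nat_le x z.
Proof. by rewrite /nat_le => xy <-; rewrite addrA xy. Qed.

Lemma nat_le0x x : nat_le 0 x.
Proof. exact: add0r. Qed.

Lemma nat_le_x0 x : nat_le x 0 <-> x = 0.
Proof. by rewrite /nat_le addr0. Qed.

Lemma nat_le_csum (I : indexType) (m : I -> R) u :
  nat_le (csum m) u <-> forall i, nat_le (m i) u.
Proof.
split=> [mu i|mu].
  by apply: nat_le_trans mu; rewrite /nat_le (csumD1 i) addrA addrr.
have [[i0]|I0] := pselect (inhabited I); last first.
  by rewrite csum0; [exact: nat_le0x|move=> i; apply: I0].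
(* By idempotence [u] is the sum of a constant family over [I], so the equalities m i + u = u can be
   summed. *)
by rewrite /nat_le -{1}(idR i0 u) -csumD -[RHS](idR i0 u); apply: eq_csum.
Qed.

Lemma le_csum (I : indexType) (m : I -> R) i : nat_le (m i) (csum m).
Proof. by move: i; apply/nat_le_csum/nat_le_refl. Qed.

Lemma nat_leD x y u : nat_le (x + y) u <-> nat_le x u /\ nat_le y u.
Proof.
rewrite -(csum_bool (fun b : bool => if b then x else y)) nat_le_csum.
split=> [h|[hx hy] []//]; split; [exact: (h true)|exact: (h false)].
Qed.

Lemma nat_le_mulr x y z : nat_le x y -> nat_le (x * z) (y * z).
Proof. by rewrite /nat_le -hmulDl => ->. Qed.

Lemma nat_le_mull x y z : nat_le x y -> nat_le (z * x) (z * y).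
Proof. by rewrite /nat_le -hmulDr => ->. Qed.

Lemma le_greatest x : nat_le x (greatest R).
Proof. exact: (le_csum id). Qed.

End NaturalOrder.

(* The argument idR only serves to make the lattice structure inferable. *)
Record right_fixed (R : completeHemiringType) (idR : csum_idempotent R) (u : R) :=
  RightFixed { rf_val :> R; rf_valP : (rf_val * u)%g = rf_val }.

(** * The complete lattice of right-fixed elements and the left action on it *)

Section RightFixedLattice.
Local Open Scope ring_scope.
Local Open Scope group_scope.
Context (R : completeHemiringType) (idR : csum_idempotent R) (u : R).
Local Notation M := (right_fixed idR u).
Implicit Types x y z : M.

Lemma rf_val_inj x y : rf_val x = rf_val y -> x = y.
Proof.
case: x y => [x xP] [y yP] /= xy.
by rewrite -{}xy in yP *; congr RightFixed; apply: Prop_irrelevance.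
Qed.

HB.instance Definition _ := gen_eqMixin M.
HB.instance Definition _ := gen_choiceMixin M.

Fact rf_display : Order.disp_t. Proof. exact: Order.Disp tt tt. Qed.

Definition rf_le x y := `[< nat_le x y >].

Lemma rf_le_refl : reflexive rf_le.
Proof. by move=> x; apply/asboolP/nat_le_refl. Qed.

Lemma rf_le_anti : antisymmetric rf_le.
Proof.
by move=> x y /andP[/asboolP xy /asboolP yx]; apply/rf_val_inj/nat_le_anti.
Qed.

Lemma rf_le_trans : transitive rf_le.
Proof.
by move=> y x z /asboolP xy /asboolP yz; apply/asboolP/(nat_le_trans xy).
Qed.

HB.instance Definition _ := Order.Le_isPOrder.Build rf_display M
  rf_le_refl rf_le_anti rf_le_trans.

Lemma rf_leP x y : reflect (nat_le x y) (x <= y)%O.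
Proof. exact: asboolP. Qed.

Lemma rf_bigjoin_subproof (A : set M) :
  csum (fun x : A => rf_val (val x)) * u = csum (fun x : A => rf_val (val x)).
Proof. by rewrite csum_distrr; apply: eq_csum => x; rewrite rf_valP. Qed.

Definition rf_bigjoin (A : set M) : M := RightFixed idR (rf_bigjoin_subproof A).

Lemma rf_bigjoinP (A : set M) x :
  (rf_bigjoin A <= x)%O <-> forall y, A y -> (y <= x)%O.
Proof.
split=> [/rf_leP/(nat_le_csum idR) leA y Ay|leA].
  by apply/rf_leP; apply: (leA (exist _ y (mem_set Ay))).
apply/rf_leP/(nat_le_csum idR) => -[y /= Ay].
by apply/rf_leP/leA/set_mem.
Qed.

Definition rf_join x y := rf_bigjoin [set x; y].
Definition rf_meet x y := rf_bigjoin [set z | (z <= x)%O && (z <= y)%O].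

Lemma rf_joinP x y z : (rf_join x y <= z)%O = (x <= z)%O && (y <= z)%O.
Proof.
apply/idP/andP => [/rf_bigjoinP h|[xz yz]]; first by split; apply: h; [left|right].
by apply/rf_bigjoinP => _ [->|->].
Qed.

Lemma rf_meetP x y z : (x <= rf_meet y z)%O = (x <= y)%O && (x <= z)%O.
Proof.
apply/idP/andP => [xyz|[xy xz]].
  by split; apply: (le_trans xyz); apply/rf_bigjoinP => t /andP[].
have /rf_bigjoinP : (rf_meet y z <= rf_meet y z)%O by [].
by apply; rewrite /= xy.
Qed.

HB.instance Definition _ :=
  Order.POrder_MeetJoin_isLattice.Build rf_display M rf_meetP rf_joinP.

Lemma rf_le0x x : (RightFixed idR (hmul0r u) <= x)%O.
Proof. exact/rf_leP/nat_le0x. Qed.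

Lemma rf_lex1 x : (x <= rf_bigjoin setT)%O.
Proof. by have /rf_bigjoinP := lexx (rf_bigjoin setT); apply. Qed.

HB.instance Definition _ := Order.hasBottom.Build rf_display M rf_le0x.
HB.instance Definition _ := Order.hasTop.Build rf_display M rf_lex1.

Lemma rf_bigjoin_supremum (A : set M) : supremums A (rf_bigjoin A).
Proof.
split=> [x Ax|x /rf_bigjoinP //].
by have /rf_bigjoinP := lexx (rf_bigjoin A); apply.
Qed.

HB.instance Definition _ :=
  TBLattice_isComplete.Build rf_display M rf_bigjoin_supremum.

(** The join is a sum over the set {x, y}, which is a singleton when x = y; comparing upper bounds
    avoids the case distinction. *)
Lemma rf_valU x y : rf_val (x `|` y)%O = rf_val x + rf_val y.
Proof.
apply: nat_le_anti.
  rewrite -bigjoin2.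
  apply/(nat_le_csum idR) => -[z /= /set_mem /= xyz].
  have /(nat_leD idR)[] := nat_le_refl idR (rf_val x + rf_val y).
  by case: xyz => ->.
by apply/(nat_leD idR); split; apply/rf_leP; rewrite ?leUl ?leUr.
Qed.

Lemma rf_lmul_subproof (r : R) x : r * rf_val x * u = r * rf_val x.
Proof. by rewrite -mulgA rf_valP. Qed.

Definition rf_lmul (r : R) x : M := RightFixed idR (rf_lmul_subproof r x).

Lemma rf_lmul_join_preserving (r : R) : join_preserving (rf_lmul r).
Proof.
move=> A; apply/le_anti/andP; split; last first.
  apply/le_bigjoinP => _ [x Ax <-]; apply/rf_leP/nat_le_mull/rf_leP.
  exact: bigjoin_ub.
apply/rf_leP; rewrite /= csum_distrl; apply/(nat_le_csum idR) => -[x /= /set_mem Ax].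
have /rf_leP // : (rf_lmul r x <= bigjoin (rf_lmul r @` A))%O.
by apply: bigjoin_ub; exists x.
Qed.

Definition rf_act (r : R) : cEnd M := CEnd (rf_lmul_join_preserving r).

Lemma rf_act_complete_hom : complete_hom rf_act.
Proof.
split.
- by apply: cEnd_eq => x; apply: rf_val_inj; rewrite /= hmul0r.
- move=> r s; apply: cEnd_eq => x; apply: rf_val_inj.
  by rewrite [RHS]rf_valU /= hmulDl.
- by move=> r s; apply: cEnd_eq => x; apply: rf_val_inj; rewrite /= mulgA.
move=> I m; apply: cEnd_eq => x; apply/le_anti/andP; split.
  apply/rf_leP; rewrite /= csum_distrr; apply/(nat_le_csum idR) => i.
  have /rf_leP // : (rf_lmul (m i) x <= csum (rf_act \o m) x)%O.
  by apply: bigjoin_ub; exists i.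
apply/le_bigjoinP => _ [i _ <-]; apply/rf_leP/nat_le_mulr.
exact: (le_csum idR).
Qed.

End RightFixedLattice.

(** * Kernels and images of complete homomorphisms *)

Section CompleteHom.
Local Open Scope ring_scope.
Local Open Scope group_scope.
Context {R R' : completeHemiringType} (f : R -> R').

Lemma ker_complete_congruence :
  complete_hom f -> complete_congruence (fun x y => f x = f y).
Proof.
move=> [f0 fD fM fS]; split; last first.
  by move=> I m m' mm'; rewrite !fS; apply: eq_csum.
split; first by split=> // x y z -> ->.
- by move=> x x' y y'; rewrite !fD => -> ->.
- by move=> x x' y y'; rewrite !fM => -> ->.
Qed.

Lemma range_complete_subhemiring :
  complete_hom f -> complete_subhemiring (range f).
Proof.
move=> [f0 fD fM fS]; split.
- by exists 0.
- by move=> _ _ [x _ <-] [y _ <-]; exists (x + y).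
- by move=> _ _ [x _ <-] [y _ <-]; exists (x * y).
move=> I m fm; have /choice[n nP] : forall i, exists x, f x = m i.
  by move=> i; have [x _ <-] := fm i; exists x.
by exists (csum n) => //; rewrite fS; apply: eq_csum.
Qed.

End CompleteHom.

(** * Cc-simple hemirings with more than two elements *)

Section CCSimple.
Local Open Scope ring_scope.
Local Open Scope group_scope.
Context {R : completeHemiringType} (idR : csum_idempotent R).
Implicit Types (a x y z r : R) (p q : option R).
Local Notation "x <=+ y" := (nat_le x y) (at level 70, no associativity).
Local Notation T := (greatest R).

(* [None] plays the role of an adjoined identity element. *)
Definition ctx p x q : R :=
  let px := if p is Some p then p * x else x in
  if q is Some q then px * q else px.

Lemma ctx_csum (I : indexType) (m : I -> R) p q :
  ctx p (csum m) q = csum (fun i => ctx p (m i) q).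
Proof. by case: p q => [p|] [q|]; rewrite /= ?csum_distrl ?csum_distrr. Qed.

Lemma ctxD p x y q : ctx p (x + y) q = ctx p x q + ctx p y q.
Proof. by case: p q => [p|] [q|]; rewrite /= ?hmulDl ?hmulDr ?hmulDl. Qed.

Lemma ctxMl p x y q : ctx p (x * y) q = ctx p x (Some (ctx None y q)).
Proof. by case: p q => [p|] [q|] /=; rewrite ?mulgA. Qed.

Lemma ctxMr p x y q : ctx p (x * y) q = ctx (Some (ctx p x None)) y q.
Proof. by case: p q => [p|] [q|] /=; rewrite ?mulgA. Qed.

(** This is the coarsest congruence for which the elements below [a] form a union of classes. *)
Definition syntactic a x y := forall p q, ctx p x q <=+ a <-> ctx p y q <=+ a.

(** Contexts distribute over sums, and a sum is below [a] iff all its terms are. For products one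
    factor is replaced at a time, the other being absorbed into the context. *)
Lemma syntactic_congruence a : complete_congruence (syntactic a).
Proof.
split; last first.
  by move=> I m m' mm' p q; rewrite !ctx_csum !(nat_le_csum idR); split=> h i;
    apply/mm'.
split.
- split=> [x p q //|x y xy p q|x y z xy yz p q]; first by split=> /xy.
  by rewrite xy.
- by move=> x x' y y' xx' yy' p q; rewrite !ctxD !(nat_leD idR) xx' yy'.
by move=> x x' y y' xx' yy' p q; rewrite ctxMl xx' -ctxMl ctxMr yy' -ctxMr.
Qed.

Hypotheses (simR : cc_simple R) (R_gt2 : ~ ([set: R] #<= `I_2)).

Lemma syntactic_eq a x y : a <> T -> syntactic a x y -> x = y.
Proof.
move=> aT xy; have [diag|total] := simR (syntactic_congruence a).
  exact/diag.
(* If 0 and [T] were related, the empty context would give that [T] is below [a]. *)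
case: aT; apply: nat_le_anti (le_greatest idR a) _.
by apply/(total 0 T None None); apply: nat_le0x.
Qed.

Lemma greatest_neq0 : T <> 0.
Proof.
move=> T0; apply/R_gt2/card_le_2P; exists (fun=> true) => x y _.
have all0 z : z = 0 by apply/nat_le_x0; rewrite -T0; apply: le_greatest.
by rewrite (all0 x) (all0 y).
Qed.

(* Otherwise, for a = T * T, the relation [syntactic a] has at most the two
   classes of the elements below a and not below a. *)
Lemma greatest_mul : T * T = T.
Proof.
apply: contrapT => TT; apply/R_gt2/card_le_2P.
exists (fun x => `[< x <=+ T * T >]) => x y exy; have xy := asbool_eq_equiv exy.
have mulTT z t : z * t <=+ T * T.
  apply: nat_le_trans (nat_le_mulr _ (le_greatest idR z)) _.
  exact/nat_le_mull/le_greatest.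
by apply: (syntactic_eq TT) => -[p|] [q|] //=; split=> _; apply: mulTT.
Qed.

(** The element a = TxT + Tx + xT + x bounds all contexts of x. If a differed from T, x would be
    syntactically equal to 0. So a = T, and T = TaT collapses to TxT as T and addition are
    idempotent. *)
Lemma greatest_sandwich x : x <> 0 -> T * x * T = T.
Proof.
move=> x0; pose a := (T * x * T)%g + (T * x)%g + ((x * T)%g + x).
have [aTx aT ax] : [/\ T * x * T <=+ a /\ T * x <=+ a, x * T <=+ a & x <=+ a].
  by have /(nat_leD idR)[/(nat_leD idR)? /(nat_leD idR)[]] := nat_le_refl idR a.
have Ta : a = T.
  apply: contrapT => /syntactic_eq aTE; apply/x0/aTE => p q.
  split=> _; first by case: p q => [p|] [q|];
    rewrite /= ?hmulr0 ?hmul0r //; apply: nat_le0x.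
  have [le_p le_q] := (fun r => le_greatest idR r, fun r => le_greatest idR r).
  case: p q => [p|] [q|] //=.
  - apply: nat_le_trans aTx.1.
    by apply: nat_le_trans (nat_le_mull _ (le_q q)) _; do 2 apply: nat_le_mulr.
  - exact: nat_le_trans (nat_le_mulr _ (le_p p)) aTx.2.
  - exact: nat_le_trans (nat_le_mull _ (le_q q)) aT.
have : T * a * T = T by rewrite Ta !greatest_mul.
rewrite /a !hmulDr !hmulDl !mulgA greatest_mul -!(mulgA _ T T) greatest_mul.
by rewrite !(addrr idR).
Qed.

(** If every left annihilator of [a] killed [x], the same contexts would annihilate [a] and a + x;
    [syntactic_eq] at 0 would then give a = a + x. *)
Lemma annihilator_separates a x : a * T = a -> x * T = x -> ~ x <=+ a ->
  exists2 r, r * a = 0 & r * x <> 0.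
Proof.
move=> aT xT xa; apply: contrapT => no.
have mulT_neq0 z : z <> 0 -> T * z <> 0.
  by move=> /greatest_sandwich TzT Tz0; apply: greatest_neq0; rewrite -TzT Tz0 hmul0r.
have ctx_eq0 p : ctx p a None = 0 -> ctx p x None = 0.
  move=> pa; apply: contrapT => px; apply: no; case: p pa px => [p|] /= pa px.
    by exists p.
  by exists T; [rewrite pa hmulr0|apply: mulT_neq0].
apply: xa; rewrite /nat_le addrC; apply/esym/(@syntactic_eq 0).
  by move=> /esym/greatest_neq0.
move=> p q; rewrite ctxD (nat_leD idR); split=> [pa|[] //]; split=> //.
case: q pa => [q|] /nat_le_x0 paq; apply/nat_le_x0; last exact: ctx_eq0.
have ctxS y : ctx p y (Some q) = ctx p y None * q by case: (p).
rewrite !ctxS in paq *.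
have [/ctx_eq0 ->|pa] := pselect (ctx p a None = 0); first exact: hmul0r.
have pT : ctx p a None * T = ctx p a None by case: (p) => [p'|] /=; rewrite -?mulgA aT.
(* Write c for the nonzero [ctx p a None]. Then Tq = TcTq = Tcq = 0, which forces q = 0. *)
have -> : q = 0; last exact: hmulr0.
apply: contrapT => /mulT_neq0; apply.
by rewrite -(greatest_sandwich pa) -!(mulgA T) pT paq hmulr0.
Qed.

Local Notation M := (right_fixed idR T).

Lemma range_rf_act_dense : dense_in_cEnd (range (@rf_act R idR T)).
Proof.
move=> a b; pose s : R := csum (fun r : [set r : R | r * rf_val a = 0] => val r).
have sa : s * rf_val a = 0.
  rewrite /s csum_distrr -[RHS](csum_eq0 [set r : R | r * rf_val a = 0]).
  by apply: eq_csum => -[r /= /set_mem].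
exists (rf_val b * (T * s)) => //; apply: cEnd_eq => x; apply: rf_val_inj.
rewrite /= /e_fun -!mulgA; case: ifPn => [/rf_leP xa|/rf_leP xa].
  have -> : s * rf_val x = 0; last by rewrite !hmulr0.
  by apply/nat_le_x0; rewrite -sa; apply: nat_le_mull.
have [r ra rx] := annihilator_separates (rf_valP a) (rf_valP x) xa.
have sx : s * rf_val x <> 0.
  move=> sx0; apply/rx/nat_le_x0; rewrite -sx0; apply: nat_le_mulr.
  exact: (le_csum idR (fun r : [set r : R | r * rf_val a = 0] => val r)
    (exist _ r (mem_set ra))).
(* Since xT = x, the sandwich identity reads T(sx) = T, and bT = b. *)
have := greatest_sandwich sx; rewrite -!mulgA rf_valP => ->.
exact: rf_valP.
Qed.

(** The kernel is a complete congruence. Were it total, [T] and 0 would act alike on [T] itself,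
    giving T = T * T = 0. *)
Lemma rf_act_inj : injective (@rf_act R idR T).
Proof.
have [diag|total] := simR (ker_complete_congruence (rf_act_complete_hom idR T)).
  by move=> x y /diag.
case: greatest_neq0; rewrite -greatest_mul -[RHS](hmul0r T).
have /(congr1 (fun f : cEnd M => rf_val (f (RightFixed idR greatest_mul)))) := total T 0.
by [].
Qed.

End CCSimple.

(** * Dense subhemirings are congruence-simple *)

Section Dense.
Local Open Scope ring_scope.
Local Open Scope group_scope.
Context {d : Order.disp_t} {M : completeLatticeType d}.

Lemma e_end_sandwich (f : cEnd M) a b x y :
  e_end y b * f * e_end a x = if (f x <= y)%O then 0 else e_end a b.
Proof.
apply: cEnd_eq => z; transitivity (e_fun y b (f (e_fun a x z))) => //.
rewrite (fun_if (fun g : cEnd M => g z)) /= /e_fun.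
by case: (z <= a)%O; rewrite ?cEnd0 ?le0x ?if_same.
Qed.

Lemma addr_e_end_top (f : cEnd M) : f + e_end \bot%O \top%O = e_end \bot%O \top%O.
Proof.
apply: cEnd_eq => x; rewrite [LHS]/= /cEnd_add_fun /= /e_fun lex0.
by case: eqVneq => [->|_]; rewrite ?cEnd0 ?joinxx ?joinx1.
Qed.

(* If f x is not below g x, then e_{g x,b} f e_{a,x} = e_{a,b} while
   e_{g x,b} g e_{a,x} = 0, so that every e_{a,b} is congruent to 0; and e_{0,1}
   is the greatest endomorphism. *)
Lemma dense_congruence_simple (R : completeHemiringType) (S : set (cEnd M)) :
  dense_in_cEnd S -> complete_isomorphic_to R S -> congruence_simple R.
Proof.
move=> dense [h [h0 hD hM _] [hS hinj hsurj]] rho [eqr rhoD rhoM].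
have [rr rs rt] := eqr.
have hI x y : h x = h y -> x = y by apply: hinj; rewrite in_setE.
have [E hE] : exists E : M -> M -> R, forall a b, h (E a b) = e_end a b.
  have /choice[E hE] : forall p : M * M, exists r, h r = e_end p.1 p.2.
    by move=> p; have [r _ <-] := hsurj _ (dense p.1 p.2); exists r.
  by exists (fun a b => E (a, b)) => a b; rewrite hE.
have collapse x y : rho x y -> h x <> h y -> forall a b, rho (E a b) 0.
  (* Distinct maps cannot lie pointwise below each other, and [rho] is symmetric. *)
  wlog [z xz] : x y / exists z, ~~ (h x z <= h y z)%O.
    move=> wlogH xy hxy.
    have [xz|noxz] := pselect (exists z, ~~ (h x z <= h y z)%O).
      exact: (wlogH x y).
    have [yz|noyz] := pselect (exists z, ~~ (h y z <= h x z)%O).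
      by apply: (wlogH y x) => //; [exact: rs|move=> /esym].
    case: hxy; apply: cEnd_eq => z; apply/le_anti/andP; split; apply: contrapT => /negP ?;
      [apply: noxz|apply: noyz]; by exists z.
  move=> xy _ a b.
  have -> : E a b = E (h y z) b * x * E a z.
    by apply: hI; rewrite !hM !hE e_end_sandwich (negPf xz).
  have -> : 0 = E (h y z) b * y * E a z.
    by apply: hI; rewrite h0 !hM !hE e_end_sandwich lexx.
  exact: (rhoM _ _ _ _ (rhoM _ _ _ _ (rr _) xy) (rr _)).
have [[x [y [xy hxy]]]|no] := pselect (exists x y, rho x y /\ h x <> h y); last first.
  left=> x y; split=> [xy|->]; last exact: rr.
  by apply: hI; apply: contrapT => hxy; apply: no; exists x, y.
have rho0 z : rho z 0.
  have E0 := collapse x y xy hxy \bot%O \top%O.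
  (* With e = [E \bot \top], the chain is z = z + 0 ~ z + e = e ~ 0. *)
  apply: rt (E0); rewrite -{1}[z]addr0.
  have -> : E \bot%O \top%O = z + E \bot%O \top%O.
    by apply: hI; rewrite hD hE addr_e_end_top.
  exact/rhoD/rs.
by right=> z t; apply: rt (rho0 z) (rs _ _ (rho0 t)).
Qed.

End Dense.

(** * Hemirings with at most two elements, and the equivalence *)

Lemma card_le_2_congruence_simple (R : hemiringType) :
  [set: R] #<= `I_2 -> congruence_simple R.
Proof.
move=> /card_le_2P[f f_inj] rho [[rr rs rt] _ _].
have [[x [y [xy nxy]]]|no] := pselect (exists x y, rho x y /\ x <> y); last first.
  left=> x y; split=> [xy|->]; last exact: rr.
  by apply: contrapT => nxy; apply: no; exists x, y.
have two z : z = x \/ z = y.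
  have : f x <> f y by move=> /f_inj.
  case fx : (f x); case fy : (f y); case fz : (f z) => // _;
    by [left; apply: f_inj; rewrite fx|right; apply: f_inj; rewrite fy].
right=> z t; case: (two z) => ->; case: (two t) => -> //; try exact: rr.
exact: rs.
Qed.

Lemma congruence_simple_cc_simple (R : completeHemiringType) :
  congruence_simple R -> cc_simple R.
Proof. by move=> simR rho [rho_congr _]; apply: simR. Qed.

Theorem theorem4p6 (R : completeHemiringType) :
  (congruence_simple R <-> cc_simple R) /\
  (cc_simple R <->
    ([set: R] #<= `I_2 \/
     exists (d : Order.disp_t) (M : completeLatticeType d),
       (exists x : M, x <> \bot%O) /\
       exists S : set (cEnd M),
         [/\ complete_subhemiring S, dense_in_cEnd S
           & complete_isomorphic_to R S])).
Proof.
set iii := _ \/ _.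
have iii_i : iii -> congruence_simple R.
  case=> [/card_le_2_congruence_simple //|[d [M [_ [S [_ dense iso]]]]]].
  exact: dense_congruence_simple dense iso.
have ii_iii : cc_simple R -> iii.
  move=> simR; have [le2|gt2] := pselect ([set: R] #<= `I_2); [by left|right].
  have idR := cc_simple_idempotent simR.
  have act_hom := rf_act_complete_hom idR (greatest R).
  exists rf_display, (right_fixed idR (greatest R) : completeLatticeType _).
  split.
    (* The greatest element is right-fixed because T * T = T, and it is nonzero. *)
    exists (RightFixed idR (greatest_mul idR simR gt2)).
    by move=> /(congr1 (@rf_val _ _ _)); apply: (greatest_neq0 idR gt2).
  exists (range (@rf_act R idR (greatest R))); split.
  - exact: range_complete_subhemiring.
  - exact: range_rf_act_dense.
  exists (@rf_act R idR (greatest R)) => //; split=> //.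
  by move=> x y _ _; apply: rf_act_inj.
have i_ii := @congruence_simple_cc_simple R.
by split; [split=> // /ii_iii/iii_i|split=> // /iii_i/i_ii].
Qed.
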